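(* For every closed formula $A$: if $\models_{\mathfrak P}A$ for every predicate model $\mathfrak P$, then $\mathsf{m}\ell\mathsf{IKt}2\setminus\mathsf{cut}\vdash A$.
   Context: Formulas: $A ::= P \mid X \mid A\to B \mid \Box A \mid \blacksquare A \mid \forall X A$ over a set $\mathsf{Pr}$ of propositional symbols and second-order variables $X$; closed = no free variables; $A[C/X]$ capture-avoiding substitution. A predicate structure $\mathfrak P$: set $\Omega$ of states with partial order $\le$; set $W$ of modal worlds; set $\mathcal W\supseteq\mathsf{Pr}$ of sets; for $V\in\mathcal W$, $a\in\Omega$, a set $V^a\subseteq W$ with $a\le b\Rightarrow V^a\subseteq V^b$; relations $R^a\subseteq W\times W$ with $a\le b\Rightarrow R^a\subseteq R^b$. With each $V\in\mathcal W$ as a symbol: $a,v\models P$ iff $v\in P^a$; $a,v\models A\to B$ iff $\forall b\ge a$ ($b,v\models A\Rightarrow b,v\models B$); $a,v\models\Box A$ iff $\forall b\ge a\,\forall w$ ($vR^bw\Rightarrow b,w\models A$); $a,v\models\blacksquare A$ iff $\forall b\ge a\,\forall u$ ($uR^bv\Rightarrow b,u\models A$); $a,v\models\forall XA$ iff $\forall b\ge a\,\forall V\in\mathcal W$, $b,v\models A[V/X]$. $\models_{\mathfrak P}A$: $a,v\models A$ for all $a,v$. Predicate model: comprehensive, i.e. for every closed $C$ of the expanded language there is $[C]\in\mathcal W$ with $[C]^a=\{w:a,w\models C\}$ for all $a$. Labelled sequents $\mathcal R\mid\Gamma\Rightarrow\Delta$: $\mathcal R$ a set of relational atoms $vRw$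 between world symbols, $\Gamma,\Delta$ multisets of labelled formulas $v:A$ ($A$ closed). $\ell\mathsf{Kt}2$ rules (fresh = not in conclusion): id: $\mathcal R\mid v:A\Rightarrow v:A$; cut: from $\mathcal R\mid\Gamma\Rightarrow\Delta,v:A$ and $\mathcal R\mid\Gamma',v:A\Rightarrow\Delta'$ infer $\mathcal R\mid\Gamma,\Gamma'\Rightarrow\Delta,\Delta'$; weakening and contraction both sides; $\to$L: from $\mathcal R\mid\Gamma\Rightarrow\Delta,v:A$ and $\mathcal R\mid\Gamma',v:B\Rightarrow\Delta'$ infer $\mathcal R\mid\Gamma,\Gamma',v:A\to B\Rightarrow\Delta,\Delta'$; $\to$R: from $\mathcal R\mid\Gamma,v:A\Rightarrow\Delta,v:B$ infer $\mathcal R\mid\Gamma\Rightarrow\Delta,v:A\to B$; $\forall$L: from $\mathcal R\mid\Gamma,v:A[C/X]\Rightarrow\Delta$ infer $\mathcal R\mid\Gamma,v:\forall XA\Rightarrow\Delta$; $\forall$R: from $\mathcal R\mid\Gamma\Rightarrow\Delta,v:A[P/X]$ infer $\mathcal R\mid\Gamma\Rightarrow\Delta,v:\forall XA$, $P$ fresh; $\Box$L: from $\mathcal R,vRw\mid\Gamma,w:A\Rightarrow\Delta$ infer $\mathcal R,vRw\mid\Gamma,v:\Box A\Rightarrow\Delta$; $\Box$R: from $\mathcal R,vRw\mid\Gamma\Rightarrow\Delta,w:A$ infer $\mathcal R\mid\Gamma\Rightarrow\Delta,v:\Box A$, $w$ fresh; $\blacksquare$L: from $\mathcal R,uRv\mid\Gamma,u:A\Rightarrow\Delta$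 infer $\mathcal R,uRv\mid\Gamma,v:\blacksquare A\Rightarrow\Delta$; $\blacksquare$R: from $\mathcal R,uRv\mid\Gamma\Rightarrow\Delta,u:A$ infer $\mathcal R\mid\Gamma\Rightarrow\Delta,v:\blacksquare A$, $u$ fresh. $\mathsf{m}\ell\mathsf{IKt}2$ is the restriction of $\ell\mathsf{Kt}2$ in which every right logical step ($\to$R, $\forall$R, $\Box$R, $\blacksquare$R) has $\Delta=\emptyset$. $\setminus\mathsf{cut}$ omits cut. $\vdash A$ means proving $\emptyset\mid\emptyset\Rightarrow v:A$.
   Formalization: The set Pr of propositional symbols is assumed infinite; for finite Pr = {P1,…,Pn} the claim fails, since ∀X(P1→…→Pn→X→X) is valid but the ∀ right rule has no fresh symbol available. *)

(* Defs.v *)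
From Stdlib Require Import List Arith Permutation Relations FinFun.
Import ListNotations.

Set Implicit Arguments.

(** * Formulas *)

(** [S] is the set of symbols: the propositional symbols, or, for the expanded
    language of a predicate structure, the elements of its [pred] sort. *)
Inductive form (S : Type) : Type :=
| Sym (P : S)
| Var (X : nat)
| Imp (A B : form S)
| Box (A : form S)
| BBox (A : form S)
| All (X : nat) (A : form S).

Arguments Var {S} X.

Fixpoint fmap (S T : Type) (f : S -> T) (A : form S) : form T :=
  match A with
  | Sym P => Sym (f P)
  | Var X => Var X
  | Imp A B => Imp (fmap f A) (fmap f B)
  | Box A => Box (fmap f A)
  | BBox A => BBox (fmap f A)
  | All X A => All X (fmap f A)
  end.

Fixpoint free (S : Type) (X : nat) (A : form S) : Prop :=
  match A with
  | Sym _ => False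
  | Var Y => X = Y
  | Imp A B => free X A \/ free X B
  | Box A => free X A
  | BBox A => free X A
  | All Y A => X <> Y /\ free X A
  end.

Definition closed (S : Type) (A : form S) : Prop := forall X, ~ free X A.

Fixpoint occurs (S : Type) (P : S) (A : form S) : Prop :=
  match A with
  | Sym Q => P = Q
  | Var _ => False
  | Imp A B => occurs P A \/ occurs P B
  | Box A => occurs P A
  | BBox A => occurs P A
  | All _ A => occurs P A
  end.

(** [A[C/X]].  Bound variables are not renamed: the substitution is used only
    for closed [C], where no capture can happen. *)
Fixpoint subst (S : Type) (X : nat) (C A : form S) : form S :=
  match A with
  | Sym P => Sym P
  | Var Y => if Nat.eqb X Y then C else Var Y
  | Imp A B => Imp (subst X C A) (subst X C B)
  | Box A => Box (subst X C A)
  | BBox A => BBox (subst X C A)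
  | All Y A => All Y (if Nat.eqb X Y then A else subst X C A)
  end.

(** * Predicate structures and models *)

Record pred_structure (Pr : Type) : Type := {
  state : Type;
  le : state -> state -> Prop;
  le_order : order state le;
  world : Type;
  (** The set [pred] contains [Pr] through the injection [symb]; the set
      [V^a] attached to [V] and [a] is [ext V a]. *)
  pred : Type;
  symb : Pr -> pred;
  symb_inj : Injective symb;
  ext : pred -> state -> world -> Prop;
  ext_mono : forall V a b w, le a b -> ext V a w -> ext V b w;
  acc : state -> world -> world -> Prop;
  acc_mono : forall a b v w, le a b -> acc a v w -> acc b v w
}.

Definition upd (T : Type) (rho : nat -> option T) (X : nat) (V : T) :
  nat -> option T := fun Y => if Nat.eqb X Y then Some V else rho Y.

(** Forcing, with the substitutions [A[V/X]] of symbols for variables delayed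
    in [rho] so that the recursion is structural; see [forces_All]. *)
Fixpoint forces_env (Pr : Type) (M : pred_structure Pr)
    (rho : nat -> option (pred M)) (a : state M) (v : world M)
    (A : form (pred M)) : Prop :=
  match A with
  | Sym V => ext M V a v
  | Var X => match rho X with Some V => ext M V a v | None => False end
  | Imp A B => forall b, le M a b ->
      forces_env M rho b v A -> forces_env M rho b v B
  | Box A => forall b, le M a b -> forall w, acc M b v w ->
      forces_env M rho b w A
  | BBox A => forall b, le M a b -> forall u, acc M b u v ->
      forces_env M rho b u A
  | All X A => forall b, le M a b -> forall V : pred M,
      forces_env M (upd rho X V) b v A
  end.

Definition forces (Pr : Type) (M : pred_structure Pr) (a : state M)
    (v : world M) (A : form (pred M)) : Prop :=
  forces_env M (fun _ => None) a v A.

Definition valid (Pr : Type) (M : pred_structure Pr) (A : form Pr) : Prop :=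
  forall a v, forces M a v (fmap (symb M) A).

Definition comprehensive (Pr : Type) (M : pred_structure Pr) : Prop :=
  forall C : form (pred M), closed C ->
  exists V : pred M, forall a w, ext M V a w <-> forces M a w C.

Record pred_model (Pr : Type) : Type := {
  structure :> pred_structure Pr;
  model_comprehensive : comprehensive structure
}.

Lemma forces_env_ext (Pr : Type) (M : pred_structure Pr) (A : form (pred M)) :
  forall rho sigma a v, (forall X, rho X = sigma X) ->
  forces_env M rho a v A <-> forces_env M sigma a v A.
Proof.
  induction A as [P|X|A IHA B IHB|A IHA|A IHA|X A IHA];
    intros rho sigma a v E; simpl.
  - tauto.
  - rewrite E; tauto.
  - split; intros H b L F; apply (IHB rho sigma b v E), (H b L),
      (IHA rho sigma b v E), F.
  - split; intros H b L w R; apply (IHA rho sigma b w E), (H b L w R).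
  - split; intros H b L w R; apply (IHA rho sigma b w E), (H b L w R).
  - assert (E' : forall V Y, upd rho X V Y = upd sigma X V Y).
    { intros V Y; unfold upd; rewrite E; reflexivity. }
    split; intros H b L V; apply (IHA _ _ b v (E' V)), (H b L V).
Qed.

Lemma forces_env_subst (Pr : Type) (M : pred_structure Pr) (X : nat)
    (V : pred M) (A : form (pred M)) :
  forall rho a v, forces_env M rho a v (subst X (Sym V) A) <->
                  forces_env M (upd rho X V) a v A.
Proof.
  induction A as [P|Y|A IHA B IHB|A IHA|A IHA|Y A IHA];
    intros rho a v; simpl.
  - tauto.
  - unfold upd; destruct (Nat.eqb X Y); simpl; tauto.
  - split; intros H b L F; apply IHB, (H b L), IHA, F.
  - split; intros H b L w R; apply IHA, (H b L w R).
  - split; intros H b L w R; apply IHA, (H b L w R).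
  - assert (K : forall b U,
      forces_env M (upd rho Y U) b v (if Nat.eqb X Y then A
                                      else subst X (Sym V) A) <->
      forces_env M (upd (upd rho X V) Y U) b v A).
    { intros b U; destruct (Nat.eqb X Y) eqn:EXY.
      - apply Nat.eqb_eq in EXY; subst Y.
        apply forces_env_ext; intro Z; unfold upd.
        destruct (Nat.eqb X Z); reflexivity.
      - rewrite IHA; apply forces_env_ext; intro Z; unfold upd.
        destruct (Nat.eqb X Z) eqn:EXZ; destruct (Nat.eqb Y Z) eqn:EYZ;
          try reflexivity.
        apply Nat.eqb_eq in EXZ; apply Nat.eqb_eq in EYZ; subst.
        rewrite Nat.eqb_refl in EXY; discriminate. }
    split; intros H b L U; apply K, (H b L U).
Qed.

Lemma forces_All (Pr : Type) (M : pred_structure Pr) (a : state M)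
    (v : world M) (X : nat) (A : form (pred M)) :
  forces M a v (All X A) <->
  forall b, le M a b -> forall V : pred M, forces M b v (subst X (Sym V) A).
Proof.
  unfold forces; simpl.
  split; intros H b L V; apply forces_env_subst, (H b L V).
Qed.

(** * Labelled sequents *)

Definition label : Type := nat.
Definition lform (Pr : Type) : Type := (label * form Pr)%type.

(** The atom [vRw] is the pair [(v, w)], and [v:A] is the pair [(v, A)].  Sets
    and multisets are lists, identified by the rule [d_exch] below. *)
Definition label_fresh (Pr : Type) (w : label) (R : list (label * label))
    (G D : list (lform Pr)) : Prop :=
  (forall x y, In (x, y) R -> w <> x /\ w <> y) /\
  (forall x A, In (x, A) (G ++ D) -> w <> x).

Definition symbol_fresh (Pr : Type) (P : Pr) (G D : list (lform Pr)) : Prop :=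
  forall x A, In (x, A) (G ++ D) -> ~ occurs P A.

(** Derivability in lKt2 ([mono = false]) or mlIKt2 ([mono = true]), with
    ([cuts = true]) or without ([cuts = false]) the cut rule.  The closedness
    conditions ensure that only sequents of closed formulas are derivable; see
    [derivable_closed]. *)
Inductive derivable (Pr : Type) (mono cuts : bool) :
  list (label * label) -> list (lform Pr) -> list (lform Pr) -> Prop :=
| d_exch R R' G G' D D' :
    (forall p, In p R <-> In p R') -> Permutation G G' -> Permutation D D' ->
    derivable mono cuts R G D ->
    derivable mono cuts R' G' D'
| d_id R v A :
    closed A ->
    derivable mono cuts R [(v, A)] [(v, A)]
| d_cut R G G' D D' v A :
    cuts = true ->
    derivable mono cuts R G ((v, A) :: D) ->
    derivable mono cuts R ((v, A) :: G') D' ->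
    derivable mono cuts R (G ++ G') (D ++ D')
| d_wkL R G D v A :
    closed A ->
    derivable mono cuts R G D ->
    derivable mono cuts R ((v, A) :: G) D
| d_wkR R G D v A :
    closed A ->
    derivable mono cuts R G D ->
    derivable mono cuts R G ((v, A) :: D)
| d_ctrL R G D v A :
    derivable mono cuts R ((v, A) :: (v, A) :: G) D ->
    derivable mono cuts R ((v, A) :: G) D
| d_ctrR R G D v A :
    derivable mono cuts R G ((v, A) :: (v, A) :: D) ->
    derivable mono cuts R G ((v, A) :: D)
| d_impL R G G' D D' v A B :
    derivable mono cuts R G ((v, A) :: D) ->
    derivable mono cuts R ((v, B) :: G') D' ->
    derivable mono cuts R ((v, Imp A B) :: G ++ G') (D ++ D')
| d_impR R G D v A B :
    (mono = true -> D = []) ->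
    derivable mono cuts R ((v, A) :: G) ((v, B) :: D) ->
    derivable mono cuts R G ((v, Imp A B) :: D)
| d_allL R G D v X A C :
    closed C ->
    derivable mono cuts R ((v, subst X C A) :: G) D ->
    derivable mono cuts R ((v, All X A) :: G) D
| d_allR R G D v X A P :
    (mono = true -> D = []) ->
    symbol_fresh P G ((v, All X A) :: D) ->
    derivable mono cuts R G ((v, subst X (Sym P) A) :: D) ->
    derivable mono cuts R G ((v, All X A) :: D)
| d_boxL R G D v w A :
    derivable mono cuts ((v, w) :: R) ((w, A) :: G) D ->
    derivable mono cuts ((v, w) :: R) ((v, Box A) :: G) D
| d_boxR R G D v w A :
    (mono = true -> D = []) ->
    label_fresh w R G ((v, Box A) :: D) ->
    derivable mono cuts ((v, w) :: R) G ((w, A) :: D) ->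
    derivable mono cuts R G ((v, Box A) :: D)
| d_bboxL R G D u v A :
    derivable mono cuts ((u, v) :: R) ((u, A) :: G) D ->
    derivable mono cuts ((u, v) :: R) ((v, BBox A) :: G) D
| d_bboxR R G D u v A :
    (mono = true -> D = []) ->
    label_fresh u R G ((v, BBox A) :: D) ->
    derivable mono cuts ((u, v) :: R) G ((u, A) :: D) ->
    derivable mono cuts R G ((v, BBox A) :: D).

Definition proves (Pr : Type) (mono cuts : bool) (A : form Pr) : Prop :=
  forall v : label, derivable mono cuts [] [] [(v, A)].

Definition mlIKt2_nocut_proves (Pr : Type) (A : form Pr) : Prop :=
  proves true false A.

Lemma closed_All_subst (S : Type) (X : nat) (C A : form S) :
  closed (subst X C A) -> closed (All X A).
Proof.
  intros H Y [NE F]; apply (H Y); clear H; revert F.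
  induction A as [P|Z|A IHA B IHB|A IHA|A IHA|Z A IHA]; simpl; intro F.
  - exact F.
  - destruct (Nat.eqb X Z) eqn:E; [|exact F].
    apply Nat.eqb_eq in E; congruence.
  - tauto.
  - auto.
  - auto.
  - destruct (Nat.eqb X Z); tauto.
Qed.

Lemma derivable_closed (Pr : Type) (mono cuts : bool) R
    (G D : list (lform Pr)) :
  derivable mono cuts R G D -> Forall (fun p => closed (snd p)) (G ++ D).
Proof.
  intro H; apply Forall_app; induction H as
    [R R' G G' D D' _ PG PD _ [IG ID]|R v A c
    |R G G' D D' v A _ _ [IG ID] _ [IG' ID']
    |R G D v A c _ [IG ID]|R G D v A c _ [IG ID]
    |R G D v A _ [IG ID]|R G D v A _ [IG ID]
    |R G G' D D' v A B _ [IG ID] _ [IG' ID']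
    |R G D v A B _ _ [IG ID]|R G D v X A C c _ [IG ID]
    |R G D v X A P _ _ _ [IG ID]|R G D v w A _ [IG ID]
    |R G D v w A _ _ _ [IG ID]|R G D u v A _ [IG ID]
    |R G D u v A _ _ _ [IG ID]];
  rewrite ?Forall_app, ?Forall_cons_iff, ?Forall_app in *; simpl in *;
  try tauto.
  - split; [exact (Permutation_Forall PG IG)|exact (Permutation_Forall PD ID)].
  - split; split; auto.
  - repeat split; try tauto.
    intros X [F|F]; [apply (proj1 ID X F)|apply (proj1 IG' X F)].
  - repeat split; try tauto.
    intros X [F|F]; [apply (proj1 IG X F)|apply (proj1 ID X F)].
  - repeat split; try tauto. exact (@closed_All_subst _ X C A (proj1 IG)).
  - repeat split; try tauto. exact (@closed_All_subst _ X (Sym P) A (proj1 ID)).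
Qed.

(* Main.v *)
Require Import Defs.
From Stdlib Require Import List Arith Lia Permutation Relations FinFun.
From Stdlib Require Import Classical.
Import ListNotations.

Set Implicit Arguments.

(** Okada's semantic cut elimination.  States are finite contexts [R | G], and
    a predicate is a pair of a closed formula [C] and a monotone, left-saturated
    set [V] of labelled states squeezed between the contexts containing [v:C]
    and those proving [v:C] without cut.  By induction on formulas, forcing of
    any formula over these predicates is squeezed in the same way around the
    formula obtained by replacing each predicate by its [C].  Hence forcing sets
    are again predicates, which is comprehension, and forcing in the empty
    context gives cut-free provability. *)

(** * Substitution *)

Lemma subst_not_free (S : Type) (X : nat) (C A : form S) :
  ~ free X A -> subst X C A = A.
Proof.
  induction A as [P|Y|A IHA B IHB|A IHA|A IHA|Y A IHA]; simpl; intro H.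
  - reflexivity.
  - destruct (Nat.eqb_spec X Y); tauto.
  - rewrite IHA, IHB; tauto.
  - rewrite IHA; tauto.
  - rewrite IHA; tauto.
  - destruct (Nat.eqb_spec X Y); [reflexivity|rewrite IHA; tauto].
Qed.

Lemma free_subst (S : Type) (X Y : nat) (C A : form S) :
  closed C -> free Y (subst X C A) -> X <> Y /\ free Y A.
Proof.
  intro HC; induction A as [P|Z|A IHA B IHB|A IHA|A IHA|Z A IHA];
    simpl; try tauto.
  - destruct (Nat.eqb_spec X Z); simpl; intro F.
    + destruct (HC Y F).
    + subst; auto.
  - destruct (Nat.eqb_spec X Z); subst; intuition congruence.
Qed.

Lemma closed_subst (S : Type) (X : nat) (C A : form S) :
  closed C -> closed (All X A) -> closed (subst X C A).
Proof.
  intros HC HA Y F; destruct (@free_subst S X Y C A HC F) as [NE F'].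
  apply (HA Y); simpl; auto.
Qed.

(** Passing under a binder for [X] unsets [X], so that [inst] leaves the bound occurrences in
    place. *)
Definition remove_env (T : Type) (rho : nat -> option T) (X : nat) :
  nat -> option T := fun Y => if Nat.eqb X Y then None else rho Y.

Fixpoint inst (S T : Type) (g : S -> form T) (rho : nat -> option S)
    (A : form S) : form T :=
  match A with
  | Sym P => g P
  | Var X => match rho X with Some P => g P | None => Var X end
  | Imp A B => Imp (inst g rho A) (inst g rho B)
  | Box A => Box (inst g rho A)
  | BBox A => BBox (inst g rho A)
  | All X A => All X (inst g (remove_env rho X) A)
  end.

Lemma inst_ext (S T : Type) (g : S -> form T) (A : form S) :
  forall rho sigma, (forall X, rho X = sigma X) ->
  inst g rho A = inst g sigma A.
Proof.
  induction A as [P|X|A IHA B IHB|A IHA|A IHA|X A IHA];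
    intros rho sigma E; simpl.
  - reflexivity.
  - rewrite E; reflexivity.
  - rewrite (IHA _ _ E), (IHB _ _ E); reflexivity.
  - rewrite (IHA _ _ E); reflexivity.
  - rewrite (IHA _ _ E); reflexivity.
  - f_equal; apply IHA; intro Y; unfold remove_env; rewrite E; reflexivity.
Qed.

(** Syntactic counterpart of [forces_env_subst]: it turns the instance in a quantifier rule into an
    updated environment. Closedness of the values of [g] keeps the substitution from acting inside
    the inserted formulas. *)
Lemma subst_inst (S T : Type) (g : S -> form T) (X : nat) (V : S)
    (A : form S) : (forall P, closed (g P)) ->
  forall rho,
  subst X (g V) (inst g (remove_env rho X) A) = inst g (upd rho X V) A.
Proof.
  intro Hg; induction A as [P|Y|A IHA B IHB|A IHA|A IHA|Y A IHA];
    intro rho; simpl.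
  - apply subst_not_free, Hg.
  - unfold upd, remove_env; destruct (Nat.eqb_spec X Y); simpl.
    + subst; rewrite Nat.eqb_refl; reflexivity.
    + destruct (rho Y); simpl.
      * apply subst_not_free, Hg.
      * destruct (Nat.eqb_spec X Y); tauto.
  - rewrite IHA, IHB; reflexivity.
  - rewrite IHA; reflexivity.
  - rewrite IHA; reflexivity.
  - f_equal; destruct (Nat.eqb_spec X Y).
    + subst; apply inst_ext; intro Z; unfold upd, remove_env.
      destruct (Nat.eqb_spec Y Z); reflexivity.
    (* The two removals commute, so the induction hypothesis applies to [remove_env rho Y]. *)
    + rewrite (@inst_ext _ _ g A _ (remove_env (remove_env rho Y) X)).
      * rewrite IHA; apply inst_ext; intro Z; unfold upd, remove_env.
        destruct (Nat.eqb_spec X Z); destruct (Nat.eqb_spec Y Z);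
          congruence.
      * intro Z; unfold remove_env.
        destruct (Nat.eqb_spec X Z); destruct (Nat.eqb_spec Y Z); reflexivity.
Qed.

Lemma closed_inst_upd (S T : Type) (g : S -> form T) (rho : nat -> option S)
    (X : nat) (V : S) (A : form S) :
  (forall P, closed (g P)) -> closed (inst g rho (All X A)) ->
  closed (inst g (upd rho X V) A).
Proof.
  intros Hg HA; rewrite <- subst_inst by exact Hg.
  apply closed_subst; [apply Hg|exact HA].
Qed.

Lemma closed_inst (S T : Type) (g : S -> form T) (A : form S) :
  (forall P, closed (g P)) -> closed A ->
  forall rho, closed (inst g rho A).
Proof.
  intros Hg HA rho.
  assert (K : forall sigma Y, free Y (inst g sigma A) -> free Y A).
  { clear HA rho; induction A as [P|X|A IHA B IHB|A IHA|A IHA|X A IHA];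
      intros sigma Y; simpl.
    - intro F; destruct (Hg _ _ F).
    - destruct (sigma X); [intro F; destruct (Hg _ _ F)|tauto].
    - intros [F|F]; [left; eapply IHA|right; eapply IHB]; exact F.
    - apply IHA.
    - apply IHA.
    - intros [NE F]; split; [exact NE|eapply IHA; exact F]. }
  intros Y F; exact (HA Y (K rho Y F)).
Qed.

Lemma inst_fmap (S T : Type) (f : T -> S) (g : S -> form T) (A : form T) :
  (forall P, g (f P) = Sym P) ->
  forall rho, (forall X, rho X = None) -> inst g rho (fmap f A) = A.
Proof.
  intro Hfg; induction A as [P|X|A IHA B IHB|A IHA|A IHA|X A IHA];
    intros rho E; simpl.
  - apply Hfg.
  - rewrite E; reflexivity.
  - rewrite IHA, IHB by exact E; reflexivity.
  - rewrite IHA by exact E; reflexivity.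
  - rewrite IHA by exact E; reflexivity.
  - rewrite IHA; [reflexivity|].
    intro Y; unfold remove_env; rewrite E; destruct (Nat.eqb X Y); reflexivity.
Qed.

(** * Fresh symbols and labels *)

Fixpoint symbols (S : Type) (A : form S) : list S :=
  match A with
  | Sym P => [P]
  | Var _ => []
  | Imp A B => symbols A ++ symbols B
  | Box A => symbols A
  | BBox A => symbols A
  | All _ A => symbols A
  end.

Lemma occurs_symbols (S : Type) (P : S) (A : form S) :
  occurs P A -> In P (symbols A).
Proof. induction A; simpl; rewrite ?in_app_iff; intuition. Qed.

(** [Finite T] says that one list contains all of [T]; its negation yields the missing element by
    classical logic. *)
Lemma exists_notin (T : Type) (l : list T) : ~ Finite T -> exists x, ~ In x l.
Proof.
  intro H; apply not_all_ex_not; intro F; apply H; exists l; exact F.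
Qed.

Lemma exists_symbol_fresh (Pr : Type) (G D : list (lform Pr)) :
  ~ Finite Pr -> exists P, symbol_fresh P G D.
Proof.
  intro H.
  destruct (exists_notin (flat_map (fun p => symbols (snd p)) (G ++ D)) H)
    as [P HP].
  exists P; intros x A I O; apply HP, in_flat_map.
  exists (x, A); split; [exact I|apply occurs_symbols, O].
Qed.

Lemma exists_label_fresh (Pr : Type) (R : list (label * label))
    (G D : list (lform Pr)) : exists w, label_fresh w R G D.
Proof.
  set (l := map fst R ++ map snd R ++ map fst (G ++ D)).
  assert (H : forall x, In x l -> S (list_max l) <> x).
  { intros x I E.
    assert (M : Forall (fun k => k <= list_max l) l)
      by (apply list_max_le; lia).
    rewrite Forall_forall in M; specialize (M x I); lia. }
  exists (S (list_max l)); split.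
  - intros x y I; split; apply H; unfold l; rewrite !in_app_iff.
    + left; apply in_map_iff; exists (x, y); auto.
    + right; left; apply in_map_iff; exists (x, y); auto.
  - intros x A I; apply H; unfold l; rewrite app_assoc, in_app_iff.
    right; apply in_map_iff; exists (x, A); auto.
Qed.

(** * Structural rules *)

Definition all_closed (Pr : Type) (G : list (lform Pr)) : Prop :=
  Forall (fun p => closed (snd p)) G.

Section Structural.
Variables (Pr : Type) (mono cuts : bool).
Implicit Types (R : list (label * label)) (G D : list (lform Pr)).

Lemma derivable_perm R G G' D :
  Permutation G G' -> derivable mono cuts R G D -> derivable mono cuts R G' D.
Proof.
  intros P H; apply (@d_exch _ _ _ R R G G' D D); try reflexivity; assumption.
Qed.

Lemma derivable_rel R R' G D :
  (forall p, In p R <-> In p R') ->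
  derivable mono cuts R G D -> derivable mono cuts R' G D.
Proof.
  intros E H; apply (@d_exch _ _ _ R R' G G D D); try reflexivity; assumption.
Qed.

Lemma derivable_wk R G G' D :
  all_closed G' -> derivable mono cuts R G D ->
  derivable mono cuts R (G' ++ G) D.
Proof.
  intros C H; induction C as [|[v A] G' c C IH]; simpl.
  - exact H.
  - apply d_wkL; assumption.
Qed.

Lemma derivable_ctr_in R G D p :
  In p G -> derivable mono cuts R (p :: G) D -> derivable mono cuts R G D.
Proof.
  intros I H; destruct p as [v A]; destruct (in_split _ _ I) as [G1 [G2 ->]].
  apply (derivable_perm (Permutation_middle G1 G2 (v, A))), d_ctrL.
  revert H; apply derivable_perm.
  constructor; symmetry; apply Permutation_middle.
Qed.

(** Serves to merge the two copies of the antecedent that [d_impL] concatenates. *)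
Lemma derivable_ctr_incl R G G' D :
  incl G G' -> derivable mono cuts R (G ++ G') D ->
  derivable mono cuts R G' D.
Proof.
  induction G as [|p G IH]; simpl; intros I H.
  - exact H.
  - apply incl_cons_inv in I; destruct I as [I1 I2].
    apply (IH I2), (@derivable_ctr_in _ _ _ p); [|exact H].
    apply in_app_iff; auto.
Qed.

Lemma derivable_id_in R G v A :
  all_closed G -> In (v, A) G -> derivable mono cuts R G [(v, A)].
Proof.
  intros C I; destruct (in_split _ _ I) as [G1 [G2 ->]].
  unfold all_closed in C; rewrite Forall_app, Forall_cons_iff in C.
  destruct C as [C1 [c C2]]; simpl in c.
  apply (@derivable_perm _ ((G1 ++ G2) ++ [(v, A)])).
  - rewrite <- app_assoc; apply Permutation_app_head.
    symmetry; apply Permutation_cons_append.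
  - apply derivable_wk; [apply Forall_app; auto|apply d_id, c].
Qed.

End Structural.

(** * The canonical model *)

Section Model.
Variable Pr : Type.

(** * Contexts ordered by extension *)

Definition context : Type := (list (label * label) * list (lform Pr))%type.

Implicit Types (a b c : context) (p : lform Pr).

Definition size a : nat := length (fst a) + length (snd a).

(* Inclusion of lists is only a preorder; comparing the sizes makes it
   antisymmetric, and it remains compatible with adding an element. *)
Definition cle a b : Prop :=
  incl (fst a) (fst b) /\ incl (snd a) (snd b) /\ (a = b \/ size a < size b).

Definition add_form a p : context := (fst a, p :: snd a).
Definition add_atom a (e : label * label) : context := (e :: fst a, snd a).

Lemma cle_refl a : cle a a.
Proof. repeat split; auto using incl_refl. Qed.

Lemma cle_trans a b c : cle a b -> cle b c -> cle a c.
Proof.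
  intros (I & J & K) (I' & J' & K'); repeat split.
  - exact (incl_tran I I').
  - exact (incl_tran J J').
  - destruct K as [->|K]; [exact K'|].
    destruct K' as [<-|K']; right; [exact K|lia].
Qed.

Lemma cle_order : order context cle.
Proof.
  split.
  - exact cle_refl.
  - exact cle_trans.
  - intros a b (_ & _ & [E|L]) (_ & _ & [E'|L']); auto; lia.
Qed.

Lemma cle_add_form a p : cle a (add_form a p).
Proof.
  unfold cle; simpl; split; [|split]; auto using incl_refl, incl_tl.
  right; unfold size; simpl; lia.
Qed.

Lemma cle_add_atom a e : cle a (add_atom a e).
Proof.
  unfold cle; simpl; split; [|split]; auto using incl_refl, incl_tl.
Qed.

Lemma add_form_mono a b p : cle a b -> cle (add_form a p) (add_form b p).
Proof.
  intros (I & J & K); repeat split; simpl.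
  - exact I.
  - apply incl_cons; [left; reflexivity|apply incl_tl, J].
  - destruct K as [->|K]; [left; reflexivity|right].
    unfold size in *; simpl; lia.
Qed.

(** * Cut-free provability and left rules *)

(** States may contain open formulas, and no sequent with an open formula is derivable; hence the
    guard [all_closed]. *)
Definition prov a p : Prop :=
  all_closed (snd a) -> derivable true false (fst a) (snd a) [p].

(* Quantifying over extensions gives monotonicity for free; the calculus has
   no weakening rule for relational atoms. *)
Definition hprov a p : Prop := forall b, cle a b -> prov b p.

Lemma hprov_prov a p : hprov a p -> prov a p.
Proof. intro H; apply H, cle_refl. Qed.

(* [admits a p]: some left rule introduces a formula already in [a], with [p]
   as the active formula of its premise. *)
Inductive admits a : lform Pr -> Prop :=
| admits_imp v A B :
    In (v, Imp A B) (snd a) -> hprov a (v, A) -> admits a (v, B)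
| admits_all v X A C :
    In (v, All X A) (snd a) -> closed C -> admits a (v, subst X C A)
| admits_box v w A :
    In (v, w) (fst a) -> In (v, Box A) (snd a) -> admits a (w, A)
| admits_bbox u v A :
    In (u, v) (fst a) -> In (v, BBox A) (snd a) -> admits a (u, A).

(** The implication case is the reason why [admits_imp] asks for [hprov] and not just [prov]. *)
Lemma admits_mono a b p : cle a b -> admits a p -> admits b p.
Proof.
  intros L H; pose proof L as (I & J & _); destruct H.
  - apply (@admits_imp b v A); [apply J; assumption|].
    intros d L'; apply H0; exact (cle_trans L L').
  - apply admits_all; [apply J|]; assumption.
  - apply (@admits_box b v); [apply I|apply J]; assumption.
  - apply (@admits_bbox b u v); [apply I|apply J]; assumption.
Qed.

Lemma admits_closed a p : all_closed (snd a) -> admits a p -> closed (snd p).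
Proof.
  intros C H; unfold all_closed in C; rewrite Forall_forall in C; destruct H.
  - intros X F; apply (C _ H X); simpl; auto.
  - apply closed_subst; [exact H0|exact (C _ H)].
  - exact (C _ H0).
  - exact (C _ H0).
Qed.

(** Each constructor of [admits] gives one left rule; its principal formula already lies in [a], so
    contraction absorbs the new copy. *)
Lemma prov_admits a p q : admits a p -> prov (add_form a p) q -> prov a q.
Proof.
  intros H K C.
  assert (D : derivable true false (fst a) (p :: snd a) [q]).
  { apply K; constructor; [exact (admits_closed C H)|exact C]. }
  (* [d_boxL] and [d_bboxL] want their atom at the head of the list; prepending an atom already
     present leaves the set unchanged. *)
  assert (E : forall e : label * label, In e (fst a) ->
                forall f, In f (fst a) <-> In f (e :: fst a)).
  { intros e I f; simpl; split; [auto|intros [<-|]; auto]. }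
  clear K; destruct H as [v A B I J|v X A B I J|v w A I J|u v A I J].
  - apply (@derivable_ctr_incl _ _ _ _ (snd a)); [apply incl_refl|].
    apply (@derivable_ctr_in _ _ _ _ _ _ (v, Imp A B)).
    + apply in_app_iff; auto.
    + apply (d_impL (D := [])); [apply (hprov_prov J C)|exact D].
  - apply (derivable_ctr_in (p := (v, All X A)) I).
    apply (d_allL (C := B) _ _ J D).
  - apply (@derivable_ctr_in _ _ _ _ _ _ _ J).
    apply (@derivable_rel _ _ _ _ _ _ _ (fun f => iff_sym (E _ I f))), d_boxL.
    exact (@derivable_rel _ _ _ _ _ _ _ (E _ I) D).
  - apply (@derivable_ctr_in _ _ _ _ _ _ _ J).
    apply (@derivable_rel _ _ _ _ _ _ _ (fun f => iff_sym (E _ I f))), d_bboxL.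
    exact (@derivable_rel _ _ _ _ _ _ _ (E _ I) D).
Qed.

(** * Predicates and the canonical structure *)

(** These play the role of Girard's reducibility candidates. Carrying [cform] along lets
    [inst cform] read a formula over predicates back into the calculus. *)
Record candidate : Type := {
  cform : form Pr;
  cform_closed : closed cform;
  cval : context -> label -> Prop;
  cval_mono : forall a b v, cle a b -> cval a v -> cval b v;
  cval_sat : forall a p v, admits a p -> cval (add_form a p) v -> cval a v;
  cval_in : forall a v, In (v, cform) (snd a) -> cval a v;
  cval_out : forall a v, cval a v -> prov a (v, cform)
}.

(** The largest set that [cval_mono] and [cval_out] together allow for [Sym P]. *)
Definition sym_candidate (P : Pr) : candidate.
Proof.
  refine {| cform := Sym P; cval := fun a v => hprov a (v, Sym P) |}.
  - intros X F; exact F.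
  - intros a b v L H c L'; apply H, (cle_trans L L').
  - intros a p v H K b L; apply (prov_admits (admits_mono L H)).
    apply K, add_form_mono, L.
  - intros a v I b (_ & J & _) C.
    exact (@derivable_id_in _ _ _ _ _ _ _ C (J _ I)).
  - intros a v; apply hprov_prov.
(* Transparent, so that [cform (sym_candidate P)] computes to [Sym P]. *)
Defined.

Lemma sym_candidate_inj : Injective sym_candidate.
Proof. intros P Q E; apply (f_equal cform) in E; injection E; auto. Qed.

Definition canonical : pred_structure Pr := {|
  state := context;
  le := cle;
  le_order := cle_order;
  world := label;
  pred := candidate;
  symb := sym_candidate;
  symb_inj := sym_candidate_inj;
  ext := cval;
  ext_mono := cval_mono;
  acc := fun a v w => In (v, w) (fst a);
  acc_mono := fun a b v w L => proj1 L (v, w)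
|}.

(** * Forcing in the canonical structure *)

(** Case analysis suffices, because every compound clause already quantifies over extensions. *)
Lemma forces_env_mono (A : form candidate) (rho : nat -> option candidate)
    a b (v : label) :
  cle a b -> forces_env canonical rho a v A -> forces_env canonical rho b v A.
Proof.
  intro L; destruct A as [V|X|A B|A|A|X A]; simpl.
  - apply cval_mono, L.
  - destruct (rho X); [apply cval_mono, L|tauto].
  - intros H c L'; apply H, (cle_trans L L').
  - intros H c L'; apply H, (cle_trans L L').
  - intros H c L'; apply H, (cle_trans L L').
  - intros H c L'; apply H, (cle_trans L L').
Qed.

(** Saturation passes through every connective because [admits a p] persists to each extension of
    [a], and adding [p] on both sides preserves the order. *)
Lemma forces_env_sat (A : form candidate) :
  forall (rho : nat -> option candidate) a p (v : label), admits a p ->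
  forces_env canonical rho (add_form a p) v A ->
  forces_env canonical rho a v A.
Proof.
  induction A as [V|X|A IHA B IHB|A IHA|A IHA|X A IHA];
    intros rho a p v K; simpl.
  - apply cval_sat, K.
  - destruct (rho X); [apply cval_sat, K|tauto].
  - intros H b L F; apply (IHB rho b p v (admits_mono L K)).
    apply H; [apply add_form_mono, L|].
    exact (forces_env_mono _ _ _ (cle_add_form b p) F).
  - intros H b L w I; apply (IHA rho b p w (admits_mono L K)).
    apply H; [apply add_form_mono, L|exact I].
  - intros H b L u I; apply (IHA rho b p u (admits_mono L K)).
    apply H; [apply add_form_mono, L|exact I].
  - intros H b L V; apply (IHA _ b p v (admits_mono L K)).
    apply H, add_form_mono, L.
Qed.

Hypothesis Pr_infinite : ~ Finite Pr.

(** The halves are proved together because implication swaps them in its antecedent. For the first,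
    the active formula of a left rule is added to the state and then discharged by [forces_env_sat];
    for the second, a right rule is applied, its succedent being a single formula as [mono = true]
    demands. *)
Lemma forces_env_adequate (A : form candidate) :
  forall (rho : nat -> option candidate) a (v : label),
  closed (inst cform rho A) ->
  (In (v, inst cform rho A) (snd a) -> forces_env canonical rho a v A) /\
  (forces_env canonical rho a v A -> prov a (v, inst cform rho A)).
Proof.
  induction A as [V|X|A IHA B IHB|A IHA|A IHA|X A IHA];
    intros rho a v C; simpl in *.
  - split; [apply cval_in|apply cval_out].
  - destruct (rho X) as [V|].
    + split; [apply cval_in|apply cval_out].
    (* An unassigned variable would be free in a closed formula. *)
    + destruct (C X); simpl; reflexivity.
  - assert (CA : closed (inst cform rho A))
      by (intros X F; apply (C X); left; exact F).
    assert (CB : closed (inst cform rho B))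
      by (intros X F; apply (C X); right; exact F).
    split.
    + intros I b L F.
      apply (@forces_env_sat _ _ _ (v, inst cform rho B)).
      * apply (@admits_imp b v (inst cform rho A)); [apply L, I|].
        (* The antecedent stays forced in every extension [c], hence is provable there, which is
           what [hprov] asks. *)
        intros c L'; apply IHA; [exact CA|].
        exact (forces_env_mono _ _ _ L' F).
      * apply IHB; [exact CB|left; reflexivity].
    + intros F K; apply d_impR; [reflexivity|].
      apply (proj2 (IHB rho (add_form a (v, inst cform rho A)) v CB)).
      * apply F; [apply cle_add_form|].
        apply IHA; [exact CA|left; reflexivity].
      * constructor; [exact CA|exact K].
  - split.
    + intros I b L w J.
      apply (@forces_env_sat _ _ _ (w, inst cform rho A)).
      * apply (@admits_box b v); [exact J|apply L, I].
      * apply IHA; [exact C|left; reflexivity].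
    + intros F K.
      destruct (exists_label_fresh (fst a) (snd a)
                  [(v, Box (inst cform rho A))]) as [w Hw].
      apply (@d_boxR _ _ _ _ _ _ _ w); [reflexivity|exact Hw|].
      apply (proj2 (IHA rho (add_atom a (v, w)) w C)); [|exact K].
      apply F; [apply cle_add_atom|left; reflexivity].
  - split.
    + intros I b L u J.
      apply (@forces_env_sat _ _ _ (u, inst cform rho A)).
      * apply (@admits_bbox b u v); [exact J|apply L, I].
      * apply IHA; [exact C|left; reflexivity].
    + intros F K.
      destruct (exists_label_fresh (fst a) (snd a)
                  [(v, BBox (inst cform rho A))]) as [u Hu].
      apply (@d_bboxR _ _ _ _ _ _ u); [reflexivity|exact Hu|].
      apply (proj2 (IHA rho (add_atom a (u, v)) u C)); [|exact K].
      apply F; [apply cle_add_atom|left; reflexivity].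
  - assert (E := fun V => @subst_inst _ _ cform X V A cform_closed rho).
    assert (CV : forall V, closed (inst cform (upd rho X V) A))
      by (intro V; exact (@closed_inst_upd _ _ cform rho X V A cform_closed C)).
    split.
    + intros I b L V.
      apply (@forces_env_sat _ _ _ (v, inst cform (upd rho X V) A)).
      * rewrite <- E; apply admits_all; [apply L, I|apply cform_closed].
      * apply IHA; [apply CV|left; reflexivity].
    + intros F K.
      destruct (exists_symbol_fresh (snd a)
                  [(v, All X (inst cform (remove_env rho X) A))] Pr_infinite)
        as [P HP].
      apply (@d_allR _ _ _ _ _ _ _ _ _ P); [reflexivity|exact HP|].
      (* Giving [X] the candidate of the fresh symbol as its value turns the premise of [d_allR]
         into an instance of the induction hypothesis. *)
      change (Sym P) with (cform (sym_candidate P)); rewrite E.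
      apply (proj2 (IHA (upd rho X (sym_candidate P)) a v (CV _))); [|exact K].
      apply F, cle_refl.
Qed.

(** * Comprehension and completeness *)

(** Forcing quantifies over all candidates, yet may itself be the [cval] of one, since [Prop] is
    impredicative. *)
Lemma canonical_comprehensive : comprehensive canonical.
Proof.
  intros C HC.
  assert (K : closed (inst cform (fun _ => None) C))
    by (apply closed_inst; [exact cform_closed|exact HC]).
  exists {|
    cform := inst cform (fun _ => None) C;
    cform_closed := K;
    cval := fun a v => forces canonical a v C;
    cval_mono := forces_env_mono C (fun _ => None);
    cval_sat := forces_env_sat C (fun _ => None);
    cval_in := fun a v => proj1 (forces_env_adequate C _ a v K);
    cval_out := fun a v => proj2 (forces_env_adequate C _ a v K)
  |}.
  intros a w; simpl; tauto.
Qed.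

Definition canonical_model : pred_model Pr :=
  Build_pred_model canonical_comprehensive.

Lemma canonical_valid (A : form Pr) :
  closed A -> valid canonical A -> mlIKt2_nocut_proves A.
Proof.
  intros HA H v.
  assert (E : inst cform (fun _ => None) (fmap sym_candidate A) = A)
    by (apply inst_fmap; reflexivity).
  rewrite <- E.
  apply (proj2 (@forces_env_adequate (fmap sym_candidate A) (fun _ => None)
                  ([], []) v ltac:(rewrite E; exact HA))).
  - apply H.
  - constructor.
Qed.

End Model.

Theorem theorem6p1 (Pr : Type) (Pr_infinite : ~ Finite Pr)
    (A : form Pr) (A_closed : closed A) :
  (forall M : pred_model Pr, valid M A) -> mlIKt2_nocut_proves A.
Proof.
  intro H; apply (canonical_valid Pr_infinite A_closed).
  exact (H (canonical_model Pr_infinite)).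
Qed.
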